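(* Let the system $S$ be a register of $n$ qubits, $\mathcal H_S=(\mathbb C^2)^{\otimes n}$, coupled to a bath with finite-dimensional Hilbert space $\mathcal H_B$ and initial bath state $|\varphi_0\rangle\in\mathcal H_B$. Any Hermitian perturbation $V$ on $\mathcal H_S\otimes\mathcal H_B$ may be written as $$V=\sum_{\alpha} c^\alpha P^\alpha\otimes B^\alpha ,$$ with $c^\alpha$ real, $P^\alpha\in\{\mathbf 1,\sigma^x,\sigma^y,\sigma^z\}^{\otimes n}$ and $B^\alpha$ operators on $\mathcal H_B$; in this form there are at most $4^n=2^{2n}$ linearly independent terms. Assume that adding a qubit does not change how the former qubits couple to the bath, so that $c^\alpha$ and $B^\alpha$ do not depend on $n$. Then, for an initial system state $|\psi\rangle$ in a decoherence-free subspace of the unperturbed Hamiltonian $H_0$, the dynamical fidelity susceptibility $\chi$ under the perturbation $H_0+\varepsilon V$ satisfies $$\chi=O(2^{4n}).$$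
   Context: A Pauli string on $n$ qubits is identified with the string on $n+1$ qubits obtained by appending $\mathbf 1$ on the added qubit; ''$c^\alpha$ and $B^\alpha$ do not depend on $n$'' means that the coefficient and bath operator attached to a given string stay the same when qubits are added. Unperturbed Hamiltonians have the form $H_0=H_S\otimes\mathbf 1+\mathbf 1\otimes H_B+H_{SB}$, where $H_S$ acts on the system, $H_B$ on the bath, and $H_{SB}$ is a system-bath interaction. Units with $\hbar=1$. For real $\varepsilon$ and $t\ge0$, put $H=H_0+\varepsilon V$ and, with $|\Psi\rangle=|\psi\rangle\otimes|\varphi_0\rangle$ and unit vectors $|\psi\rangle$, $|\varphi_0\rangle$, $\rho_S(\varepsilon,t)=\mathrm{tr}_B(e^{-itH}|\Psi\rangle\langle\Psi|e^{itH})$, where $\mathrm{tr}_B$ is the partial trace over $\mathcal H_B$. A decoherence-free subspace (for $H_0$ and $|\varphi_0\rangle$) is a subspace $D\subset\mathcal H_S$ such that for all unit vectors $|\psi\rangle\in D$ and all $t\ge0$ one has $\rho_S(0,t)=e^{-itH_S}|\psi\rangle\langle\psi|e^{itH_S}$ and $e^{-itH_S}|\psi\rangle\in D$. The dynamical fidelity is $F=F[\rho_S(0,t),\rho_S(\varepsilon,t)]$, where $F(\sigma,\eta)=\left[\mathrm{tr}\sqrt{\sqrt\sigma\,\eta\,\sqrt\sigma}\right]^2$; for $|\psi\rangle$ in a decoherence-free subspace it equals $\langle\psi|e^{itH_S}\rho_S(\varepsilon,t)e^{-itH_S}|\psi\rangle$. The dynamical fidelity susceptibility is $\chi=-\frac14\frac{\partial^2}{\partial\varepsilon^2}\frac{\partial^2F}{\partial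 t^2}\big|_{\varepsilon=t=0}$.
   Formalization: The formal theorem also assumes that the matrix entries of c^α B^α are bounded uniformly over all Pauli strings and all n; without this, couplings on newly added qubits may grow (e.g. V = Σ_k 5^{2k} σ^x_k with H_0 = 0) and χ = O(2^{4n}) fails. *)

(* Defs.v *)
From HB Require Import structures.
From mathcomp Require Import all_boot all_order all_algebra.
From mathcomp Require Import complex mxtens.
From mathcomp Require Import all_classical all_reals all_analysis.

Set Implicit Arguments.
Unset Strict Implicit.
Unset Printing Implicit Defensive.

Import Order.TTheory GRing.Theory Num.Theory.
Import numFieldNormedType.Exports.

Local Open Scope classical_set_scope.
Local Open Scope sesquilinear_scope.
Local Open Scope complex_scope.
Local Open Scope ring_scope.

(* The dimension 2 ^ n of the register, in a form for which
   qdim n.+1 = qdim n * 2 holds by computation. *)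
Fixpoint qdim (n : nat) : nat := if n is n'.+1 then (qdim n' * 2)%N else 1%N.

Lemma qdimE n : qdim n = (2 ^ n)%N.
Proof. by elim: n => //= n ->; rewrite expnSr. Qed.

Section Matrices.
Variable R : realType.
Local Notation C := R[i].

(* 0, 1, 2, 3 stand for the identity and the Pauli matrices x, y, z. *)
Definition pauli (k : 'I_4) : 'M[C]_2 :=
  \matrix_(i < 2, j < 2)
    match val k with
    | 0 => if i == j then 1 else 0
    | 1 => if i == j then 0 else 1
    | 2 => if i == j then 0 else if i == 0 then 0 -i* 1 else 0 +i* 1
    | _ => if i == j then (if i == 0 then 1 else - 1) else 0
    end.

Fixpoint pauli_prod (n : nat) (a : nat -> 'I_4) : 'M[C]_(qdim n) :=
  if n is n'.+1 return 'M[C]_(qdim n)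
  then pauli_prod n' a *t pauli (a n') else 1%:M.

(* The last factor sits on the last qubit, so that appending the letter 0
   to a string tensors its operator with the identity of the added qubit. *)
Definition pauli_string (n : nat) (alpha : n.-tuple 'I_4) : 'M[C]_(qdim n) :=
  pauli_prod n (nth ord0 alpha).

Definition pert_term n d (c : n.-tuple 'I_4 -> R) (B : n.-tuple 'I_4 -> 'M[C]_d)
    (alpha : n.-tuple 'I_4) : 'M[C]_(qdim n * d) :=
  (c alpha)%:C *: (pauli_string alpha *t B alpha).

Definition pert n d (c : n.-tuple 'I_4 -> R) (B : n.-tuple 'I_4 -> 'M[C]_d) :
    'M[C]_(qdim n * d) :=
  \sum_(alpha : n.-tuple 'I_4) pert_term c B alpha.

Definition hermitian_op m (A : 'M[C]_m) : Prop := A ^t* = A.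

Definition unit_vector m (v : 'cV[C]_m) : Prop := v ^t* *m v = 1%:M.

(* The exponential series, summed entry by entry. *)
Definition expmx m (A : 'M[C]_m) : 'M[C]_m :=
  \matrix_(i < m, j < m)
    (limn (series (fun k => complex.Re ((A ^+ k) i j) / k`!%:R)) +i*
     limn (series (fun k => complex.Im ((A ^+ k) i j) / k`!%:R))).

(* exp(- i t H) *)
Definition evolution m (H : 'M[C]_m) (t : R) : 'M[C]_m :=
  expmx ((0 -i* t) *: H).

Definition ptraceB m d (M : 'M[C]_(m * d)) : 'M[C]_m :=
  \matrix_(i < m, j < m)
    \sum_(k < d) M (mxtens_index (i, k)) (mxtens_index (j, k)).

(* Square root of a positive semidefinite matrix by functional calculus:
   spectralmx A is unitary and A = (spectralmx A)^-1 diag (spectralmx A). *)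
Definition sqrtmx m (A : 'M[C]_m) : 'M[C]_m :=
  invmx (spectralmx A) *m diag_mx (map_mx sqrtC (spectral_diag A))
    *m spectralmx A.

Definition fidelity m (sigma eta : 'M[C]_m) : C :=
  (\tr (sqrtmx (sqrtmx sigma *m eta *m sqrtmx sigma))) ^+ 2.

Definition unperturbed m d (HS : 'M[C]_m) (HB : 'M[C]_d)
    (HSB : 'M[C]_(m * d)) : 'M[C]_(m * d) :=
  HS *t 1%:M + 1%:M *t HB + HSB.

Definition proj_ket m (v : 'cV[C]_m) : 'M[C]_m := v *m v ^t*.

(* The partial trace over the bath of exp(- i t H) |Psi><Psi| exp(i t H),
   where Psi is the tensor product of psi and phi. *)
Definition reduced_state m d (H : 'M[C]_(m * d)) (psi : 'cV[C]_m)
    (phi : 'cV[C]_d) (t : R) : 'M[C]_m :=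
  ptraceB (evolution H t *m proj_ket (psi *t phi : 'cV[C]_(m * d))
             *m evolution H (- t)).

Definition decoherence_free m d (HS : 'M[C]_m) (H0 : 'M[C]_(m * d))
    (phi : 'cV[C]_d) (D : {vspace 'cV[C]_m}) : Prop :=
  forall (psi : 'cV[C]_m) (t : R), psi \in D -> unit_vector psi -> 0 <= t ->
    reduced_state H0 psi phi t =
      evolution HS t *m proj_ket psi *m evolution HS (- t) /\
    evolution HS t *m psi \in D.

Definition perturbed_state m d (H0 V : 'M[C]_(m * d)) (psi : 'cV[C]_m)
    (phi : 'cV[C]_d) (eps t : R) : 'M[C]_m :=
  reduced_state (H0 + eps%:C *: V) psi phi t.

(* The fidelity of two states is real; taking Re only changes its type. The formula
   is used for every real t, so that the derivatives at t = 0 are two-sided. *)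
Definition dyn_fidelity m d (H0 V : 'M[C]_(m * d)) (psi : 'cV[C]_m)
    (phi : 'cV[C]_d) (eps t : R) : R :=
  complex.Re (fidelity (perturbed_state H0 V psi phi 0 t)
               (perturbed_state H0 V psi phi eps t)).

Definition dyn_fidelity_susceptibility m d (H0 V : 'M[C]_(m * d))
    (psi : 'cV[C]_m) (phi : 'cV[C]_d) : R :=
  - (1 / 4) *
  derive1n 2 (fun eps : R => derive1n 2 (dyn_fidelity H0 V psi phi eps) 0) 0.

(* The letter 0 appended to alpha: the same string with one more qubit. *)
Definition add_qubit n (alpha : n.-tuple 'I_4) : n.+1.-tuple 'I_4 :=
  [tuple of rcons alpha ord0].

End Matrices.

(* Main.v *)
Require Import Defs.
From mathcomp Require Import all_boot all_order all_algebra.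
From mathcomp Require Import complex mxtens.
From mathcomp Require Import all_classical all_reals all_analysis.
From mathcomp Require Import ring.

Set Implicit Arguments.
Unset Strict Implicit.
Unset Printing Implicit Defensive.

Import Order.TTheory GRing.Theory Num.Theory.
Import numFieldNormedType.Exports.

Local Open Scope classical_set_scope.
Local Open Scope complex_scope.
Local Open Scope ring_scope.

(** Write Psi = psi (x) phi, K = H - HS (x) 1 and let N be the projector onto the
    orthogonal complement of psi (x) (bath space).  Against the pure state
    exp(- i t HS) psi, the fidelity equals 1 - ||N y(t)||^2, where
    y(t) = (exp(i t HS) (x) 1) exp(- i t H) Psi; since N y(0) = 0 and
    y'(0) = - i K Psi, its second derivative at t = 0 is - 2 ||N K Psi||^2.
    At eps = 0 the fidelity is constant, so N annihilates the unperturbed part of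
    K Psi and only eps V contributes: chi = ||N V Psi||^2 <= ||V Psi||^2.
    Each Pauli string is unitary, hence each of the 4 ^ n terms of V Psi has
    bounded norm and ||V Psi||^2 = O(16 ^ n).

    Decoherence freeness is assumed for t >= 0 only, while the derivatives are
    two-sided; it extends to all t because the states have entries that are
    trigonometric polynomials in t. *)

(** * Kronecker products and sums over their indices *)

Lemma sum_mxtens_index (V : nmodType) m n (F : 'I_(m * n) -> V) :
  \sum_a F a = \sum_i \sum_j F (mxtens_index (i, j)).
Proof.
rewrite pair_bigA (reindex (@mxtens_index m n)) /=.
  by apply: eq_bigr => -[i j].
by exists (@mxtens_unindex m n) => x _; rewrite (mxtens_indexK, mxtens_unindexK).
Qed.

Section TensorProduct.
Variable R : comPzRingType.

Lemma tensmx_suml (I : finType) m n p q (F : I -> 'M[R]_(m, n)) (M : 'M[R]_(p, q)) :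
  (\sum_i F i) *t M = \sum_i F i *t M.
Proof.
apply/matrixP => a b; rewrite mxE !summxE mulr_suml.
by apply: eq_bigr => i _; rewrite mxE.
Qed.

Lemma tensmxZl m n p q (a : R) (A : 'M[R]_(m, n)) (M : 'M[R]_(p, q)) :
  (a *: A) *t M = a *: (A *t M).
Proof. by apply/matrixP => i j; rewrite !mxE mulrA. Qed.

Lemma tensmx11 m n : (1%:M : 'M[R]_m) *t (1%:M : 'M[R]_n) = 1%:M.
Proof.
apply/matrixP => a b.
case: (mxtens_indexP a) => i k; case: (mxtens_indexP b) => j l.
rewrite tensmxE !mxE (can_eq (@mxtens_indexK _ _)) xpair_eqE.
by rewrite -natrM mulnb.
Qed.

End TensorProduct.

(** * Pauli strings span all operators on the register *)

Section PauliStrings.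
Local Open Scope sesquilinear_scope.
Variable R : realType.
Local Notation C := R[i].

(** The Pauli matrices form a basis of the 2 x 2 matrices. [slice a b] is the block of [A] at
    position (a, b) of the last qubit, and [A' s] is half the partial trace over that qubit of [A]
    multiplied by [pauli R s]. *)
Lemma tensmx_pauli_expansion m (A : 'M[C]_(m * 2)) :
  exists A' : 'I_4 -> 'M[C]_m, A = \sum_s A' s *t pauli R s.
Proof.
pose slice a b := \matrix_(i < m, j < m)
  A (mxtens_index (i, a)) (mxtens_index (j, b)).
pose A' (s : 'I_4) := match val s with
  | 0 => 2^-1 *: (slice 0 0 + slice 1 1)
  | 1 => 2^-1 *: (slice 0 1 + slice 1 0)
  | 2 => (2^-1 * 'i%C) *: (slice 0 1 - slice 1 0)
  | _ => 2^-1 *: (slice 0 0 - slice 1 1)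
  end.
have ii : 'i%C * 'i%C = -1 :> C by rewrite -expr2 sqr_i.
have iE : 0 +i* 1 = 'i%C :> C by [].
have niE : 0 -i* 1 = - 'i%C :> C by rewrite /GRing.opp /= oppr0.
exists A'; apply/matrixP => a b.
case: (mxtens_indexP a) => i k; case: (mxtens_indexP b) => j l.
rewrite summxE !big_ord_recl big_ord0 !tensmxE !mxE /= iE niE.
case: k => [[|[|//]] hk]; case: l => [[|[|//]] hl] /=.
- have -> : Ordinal hk = 0 by apply/val_inj.
  have -> : Ordinal hl = 0 by apply/val_inj.
  by field.
- have -> : Ordinal hk = 0 by apply/val_inj.
  have -> : Ordinal hl = 1 by apply/val_inj.
  by field: ii.
- have -> : Ordinal hk = 1 by apply/val_inj.
  have -> : Ordinal hl = 0 by apply/val_inj.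
  by field: ii.
- have -> : Ordinal hk = 1 by apply/val_inj.
  have -> : Ordinal hl = 1 by apply/val_inj.
  by field.
Qed.

Lemma eq_pauli_prod n (a b : nat -> 'I_4) :
  (forall i, (i < n)%N -> a i = b i) -> pauli_prod R n a = pauli_prod R n b.
Proof.
elim: n => //= n IHn ab; rewrite ab // IHn // => i lt_in.
by apply: ab; apply: ltnW.
Qed.

Lemma pauli_string_rcons n (alpha : n.-tuple 'I_4) s :
  pauli_string R [tuple of rcons alpha s] = pauli_string R alpha *t pauli R s.
Proof.
rewrite /pauli_string /= nth_rcons size_tuple ltnn eqxx; congr (_ *t _).
by apply: eq_pauli_prod => i lt_in; rewrite nth_rcons size_tuple lt_in.
Qed.

(** Induction on the register: expand on the last qubit, then expand each of the four coefficient
    matrices on the first n qubits. Strings of length n + 1 correspond bijectively to a string of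
    length n and a last letter. *)
Lemma pauli_expansion n (A : 'M[C]_(qdim n)) :
  exists b : n.-tuple 'I_4 -> C, A = \sum_alpha b alpha *: pauli_string R alpha.
Proof.
elim: n A => [|n IHn] A.
  exists (fun _ => A 0 0); rewrite (big_pred1 [tuple]) => [|alpha]; last first.
    by rewrite [alpha]tuple0 /= eqxx.
  by apply/matrixP => i j; rewrite !ord1 !mxE mulr1.
have [A' ->] := tensmx_pauli_expansion A.
have /choice [b bE] := fun s => IHn (A' s).
pose rc (p : n.-tuple 'I_4 * 'I_4) : n.+1.-tuple 'I_4 := [tuple of rcons p.1 p.2].
have rc_inj : injective rc.
  by move=> [u s] [v t] /(congr1 val) /= /rcons_inj [] /val_inj -> ->.
have [rc' rcK rc'K] : bijective rc.
  by apply: inj_card_bij => //; rewrite card_prod !card_tuple card_ord expnSr.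
exists (fun alpha => b (rc' alpha).2 (rc' alpha).1).
rewrite (reindex rc) /=; last by exists rc' => x _; rewrite ?rcK ?rc'K.
rewrite -(pair_bigA _ (fun u s => b (rc' (rc (u, s))).2 (rc' (rc (u, s))).1 *:
  pauli_string R (rc (u, s)))) /= exchange_big /=.
apply: eq_bigr => s _; rewrite {1}bE tensmx_suml; apply: eq_bigr => u _.
by rewrite rcK /= pauli_string_rcons tensmxZl.
Qed.

(** Fixing the bath indices k, l leaves a register operator; its Pauli coefficients become the (k,
    l) entries of the bath operators. The complex weights are thus absorbed in [B], and the real
    coefficients can all be 1. *)
Lemma pert_expansion n d (V : 'M[C]_(qdim n * d)) :
  exists (c : n.-tuple 'I_4 -> R) (B : n.-tuple 'I_4 -> 'M[C]_d), V = pert c B.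
Proof.
pose slice (kl : 'I_d * 'I_d) := \matrix_(i < qdim n, j < qdim n)
  V (mxtens_index (i, kl.1)) (mxtens_index (j, kl.2)).
have /choice [b bE] := fun kl => pauli_expansion (slice kl).
exists (fun _ => 1), (fun alpha => \matrix_(k, l) b (k, l) alpha).
apply/matrixP => x y.
case: (mxtens_indexP x) => i k; case: (mxtens_indexP y) => j l.
have := congr1 (fun M : 'M[C]_(qdim n) => M i j) (bE (k, l)).
rewrite mxE /= => ->; rewrite /pert !summxE; apply: eq_bigr => alpha _.
by rewrite /pert_term !mxE !mxtens_indexK mul1r mulrC.
Qed.

Lemma dim_span_pert_term n d (c : n.-tuple 'I_4 -> R)
    (B : n.-tuple 'I_4 -> 'M[C]_d) :
  (\dim <<[seq pert_term c B alpha | alpha : n.-tuple 'I_4]>>%VS <= 4 ^ n)%N.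
Proof.
by apply: leq_trans (dim_span _) _; rewrite size_map -cardE card_tuple card_ord.
Qed.

(** * Adjoints, and unitarity of the Pauli strings *)

Lemma trmxC_mul m n p (A : 'M[C]_(m, n)) (B : 'M[C]_(n, p)) :
  (A *m B) ^t* = B ^t* *m A ^t*.
Proof. by rewrite trmx_mul map_mxM. Qed.

(* Without the casts, *t would infer its ring from the numClosedFieldType structure
   used by ^t*, which makes unification with the other tensor products intractable. *)
Lemma trmxC_tens m n p q (A : 'M[C]_(m, n)) (B : 'M[C]_(p, q)) :
  (A *t B) ^t* = (A ^t* : 'M[C]_(n, m)) *t (B ^t* : 'M[C]_(q, p)).
Proof. by rewrite trmx_tens map_mxT. Qed.

Lemma trmxC1 m : (1%:M : 'M[C]_m) ^t* = 1%:M.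
Proof. by rewrite trmx1 map_mx1. Qed.

Lemma pauli_unitary s : (pauli R s) ^t* *m pauli R s = 1%:M.
Proof.
apply/matrixP => i j; rewrite !mxE !big_ord_recl big_ord0 addr0 !mxE.
case: s => [[|[|[|[|//]]]] hs]; case: i => [[|[|//]] hi]; case: j => [[|[|//]] hj];
  by apply/eqP; rewrite eq_complex /= ?raddf0 ?rmorph1; apply/andP; split;
     apply/eqP; simpc.
Qed.

Lemma pauli_string_unitary n (alpha : n.-tuple 'I_4) :
  (pauli_string R alpha) ^t* *m pauli_string R alpha = 1%:M.
Proof.
rewrite /pauli_string; move: (nth _ _) => a; elim: n {alpha} => [|n IHn] /=.
  by rewrite trmxC1 mulmx1.
by rewrite trmxC_tens tensmx_mul IHn pauli_unitary tensmx11.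
Qed.

(** * Squared norms and the bound on V Psi *)

Definition cnorm2 (z : C) : R := complex.Re z ^+ 2 + complex.Im z ^+ 2.

(** Valued in [R] rather than in [C], so that norms can be compared and differentiated as real
    numbers. *)
Definition sqnorm m (v : 'cV[C]_m) : R := \sum_i cnorm2 (v i 0).

Lemma cnorm2E z : (cnorm2 z)%:C = Num.conj z * z.
Proof. by rewrite /cnorm2 add_Re2_Im2 normCKC. Qed.

Lemma cnorm2_ge0 z : 0 <= cnorm2 z.
Proof. by rewrite addr_ge0 ?sqr_ge0. Qed.

Lemma cnorm2M z w : cnorm2 (z * w) = cnorm2 z * cnorm2 w.
Proof. by case: z w => [a b] [c d]; rewrite /cnorm2 /=; ring. Qed.

Lemma cnorm2_le z K : `|z| <= K%:C -> cnorm2 z <= K ^+ 2.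
Proof.
move=> zK; rewrite -lecR rmorphXn /= /cnorm2 add_Re2_Im2.
by rewrite lerXn2r ?nnegrE // (le_trans _ zK).
Qed.

Lemma sqnormE m (v : 'cV[C]_m) : v ^t* *m v = ((sqnorm v)%:C)%:M.
Proof.
apply/matrixP => i j; rewrite !ord1 !mxE /= mulr1n rmorph_sum /=.
by apply: eq_bigr => k _; rewrite !mxE cnorm2E.
Qed.

Lemma sqnorm_ge0 m (v : 'cV[C]_m) : 0 <= sqnorm v.
Proof. by apply: sumr_ge0 => i _; apply: cnorm2_ge0. Qed.

Lemma sqnorm_eq0 m (v : 'cV[C]_m) : sqnorm v = 0 -> v = 0.
Proof.
move=> v0; apply/matrixP => i j; rewrite ord1 mxE.
have /eqP := psumr_eq0P (fun i _ => cnorm2_ge0 (v i 0)) v0 (i := i) isT.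
rewrite paddr_eq0 ?sqr_ge0 // !sqrf_eq0 => /andP[/eqP re0 /eqP im0].
by apply/eqP; rewrite eq_complex re0 im0 !eqxx.
Qed.

Lemma eq_sqnorm m n (v : 'cV[C]_m) (w : 'cV[C]_n) :
  v ^t* *m v = w ^t* *m w -> sqnorm v = sqnorm w.
Proof.
rewrite !sqnormE => /matrixP /(_ 0 0); rewrite !mxE /= !mulr1n.
by case.
Qed.

Lemma sqnorm_unit m (v : 'cV[C]_m) : unit_vector v -> sqnorm v = 1.
Proof.
rewrite /unit_vector sqnormE => /matrixP /(_ 0 0); rewrite !mxE /= !mulr1n.
by case.
Qed.

Lemma sqnorm_isometry m n (A : 'M[C]_(m, n)) (v : 'cV_n) :
  A ^t* *m A = 1%:M -> sqnorm (A *m v) = sqnorm v.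
Proof.
by move=> AA; apply: eq_sqnorm; rewrite trmxC_mul -mulmxA (mulmxA _ A) AA mul1mx.
Qed.

Lemma sqnormZ m a (v : 'cV[C]_m) : sqnorm (a *: v) = cnorm2 a * sqnorm v.
Proof.
by rewrite /sqnorm mulr_sumr; apply: eq_bigr => i _; rewrite mxE cnorm2M.
Qed.

(** The nonnegative double sum of (x i - x j) ^ 2 expands to 2 (#|I| S2 - S ^ 2), with S and S2 the
    sums of the x i and of their squares. *)
Lemma sqr_sum_le (I : finType) (x : I -> R) :
  (\sum_i x i) ^+ 2 <= #|I|%:R * \sum_i x i ^+ 2.
Proof.
have : 0 <= \sum_i \sum_j (x i - x j) ^+ 2.
  by apply: sumr_ge0 => i _; apply: sumr_ge0 => j _; apply: sqr_ge0.
set S := \sum_i x i; set S2 := \sum_i x i ^+ 2.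
have inner i : \sum_j (x i - x j) ^+ 2 = #|I|%:R * x i ^+ 2 - 2 * x i * S + S2.
  rewrite (eq_bigr (fun j => x i ^+ 2 - 2 * x i * x j + x j ^+ 2)); last first.
    by move=> j _; ring.
  by rewrite big_split sumrB sumr_const -mulr_sumr
    -[x i ^+ 2 *+ _]mulr_natl.
rewrite (eq_bigr _ (fun i _ => inner i)) big_split sumrB -mulr_sumr -mulr_suml.
rewrite -mulr_sumr sumr_const -/S -/S2 /= -[S2 *+ _]mulr_natl => h.
have : 0 <= 2 * (#|I|%:R * S2 - S ^+ 2).
  by apply: le_trans h _; rewrite le_eqVlt; apply/orP; left; apply/eqP; ring.
by rewrite pmulr_rge0 // subr_ge0.
Qed.

Lemma cnorm2_sum_le (I : finType) (z : I -> C) :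
  cnorm2 (\sum_i z i) <= #|I|%:R * \sum_i cnorm2 (z i).
Proof.
have -> : cnorm2 (\sum_i z i) =
    (\sum_i complex.Re (z i)) ^+ 2 + (\sum_i complex.Im (z i)) ^+ 2.
  by rewrite /cnorm2 (raddf_sum (@complex.Re R : Rcomplex R -> R))
    (raddf_sum (@complex.Im R : Rcomplex R -> R)).
by rewrite big_split /= mulrDr lerD // sqr_sum_le.
Qed.

Lemma sqnorm_sum_le (I : finType) m (v : I -> 'cV[C]_m) :
  sqnorm (\sum_i v i) <= #|I|%:R * \sum_i sqnorm (v i).
Proof.
rewrite exchange_big mulr_sumr /=; apply: ler_sum => k _.
by rewrite summxE; apply: cnorm2_sum_le.
Qed.

(** Cauchy-Schwarz on each row. The dimension factor is harmless: the bound serves for bath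
    operators, whose size does not grow with the register. *)
Lemma sqnorm_mul_le m n (A : 'M[C]_(m, n)) (v : 'cV_n) b :
  (forall i j, cnorm2 (A i j) <= b) -> 
  sqnorm (A *m v) <= (m * n)%:R * b * sqnorm v.
Proof.
move=> Ab; have -> : (m * n)%:R * b * sqnorm v =
    \sum_(i < m) n%:R * (b * sqnorm v).
  by rewrite sumr_const card_ord -mulr_natl natrM; ring.
apply: ler_sum => i _; rewrite mxE; apply: le_trans (cnorm2_sum_le _) _.
rewrite card_ord ler_wpM2l // mulr_sumr; apply: ler_sum => j _.
by rewrite cnorm2M ler_wpM2r ?cnorm2_ge0.
Qed.

Lemma sqnorm_tens m n (u : 'cV[C]_m) (v : 'cV_n) :
  sqnorm (u *t v : 'cV_(m * n)) = sqnorm u * sqnorm v.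
Proof.
rewrite /sqnorm sum_mxtens_index mulr_suml; apply: eq_bigr => i _.
rewrite mulr_sumr; apply: eq_bigr => j _.
by rewrite mxE mxtens_indexK /= !ord1 cnorm2M.
Qed.

(** One factor 4 ^ n comes from Cauchy-Schwarz over the terms, a second from adding up their squared
    norms. Each term gives a product vector: the unitary string preserves the norm of the system
    factor, and the bath factor has squared norm at most d ^ 2 K ^ 2. *)
Lemma sqnorm_pert_le n d (c : n.-tuple 'I_4 -> R) (B : n.-tuple 'I_4 -> 'M[C]_d)
    (psi : 'cV[C]_(qdim n)) (phi : 'cV[C]_d) (K : R) :
  (forall alpha k l, `|(c alpha)%:C * B alpha k l| <= K%:C) ->
  unit_vector psi -> unit_vector phi ->
  sqnorm (pert c B *m (psi *t phi : 'cV[C]_(qdim n * d))) <=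
    (d * d)%:R * K ^+ 2 * 2 ^+ (4 * n).
Proof.
move=> cBK /sqnorm_unit psi1 /sqnorm_unit phi1.
rewrite /pert mulmx_suml; apply: le_trans (sqnorm_sum_le _) _.
have -> : (d * d)%:R * K ^+ 2 * 2 ^+ (4 * n) =
    #|{: n.-tuple 'I_4}|%:R * \sum_(alpha : n.-tuple 'I_4) ((d * d)%:R * K ^+ 2).
  move: (_ * K ^+ 2) => X.
  rewrite sumr_const card_tuple card_ord -[X *+ _]mulr_natr mulrCA -natrM.
  by rewrite -expnMn (_ : (4 * 4) = 2 ^ 4)%N // -expnM natrX.
rewrite ler_wpM2l //; apply: ler_sum => alpha _.
have -> : pert_term c B alpha *m (psi *t phi : 'cV_(qdim n * d)) =
    (pauli_string R alpha *m psi) *t (((c alpha)%:C *: B alpha) *m phi)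
    :> 'cV_(qdim n * d).
  rewrite /pert_term -scalemxAl -scalemxAl.
  (* A tensor product of two columns has 1 * 1 columns; the conversion restores that type so that
     [tensmx_mul] applies. *)
  rewrite [LHS](_ : _ = (c alpha)%:C *:
    ((pauli_string R alpha *t B alpha) *m (psi *t phi))) // tensmx_mul.
  by apply/matrixP => i j; rewrite !mxE mulrCA.
rewrite sqnorm_tens sqnorm_isometry ?pauli_string_unitary // psi1 mul1r.
apply: le_trans (sqnorm_mul_le _ (b := K ^+ 2) _) _ => [i j|].
  by rewrite mxE; apply: cnorm2_le.
by rewrite phi1 mulr1.
Qed.

End PauliStrings.

(** * Trigonometric polynomials with complex coefficients *)

Section TrigonometricPolynomials.
Variable R : realType.
Local Notation C := R[i].

Definition cis (x : R) : C := cos x +i* sin x.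

Lemma cis0 : cis 0 = 1.
Proof. by rewrite /cis cos0 sin0. Qed.

Lemma cisD x y : cis (x + y) = cis x * cis y.
Proof.
rewrite /cis cosD sinD; apply/eqP; rewrite eq_complex /=.
by apply/andP; split; apply/eqP; ring.
Qed.

Lemma cis_neq0 x : cis x != 0.
Proof.
apply/eqP => x0; have := oner_neq0 C.
by rewrite -cis0 -(subrr x) cisD x0 mul0r eqxx.
Qed.

Lemma cisN x : cis (- x) = (cis x)^-1.
Proof. by apply: (mulIf (cis_neq0 x)); rewrite -cisD addNr cis0 mulVf ?cis_neq0. Qed.

Lemma conj_cis x : Num.conj (cis x) = cis (- x).
Proof. by rewrite /cis cosN sinN. Qed.

Lemma cisMn x k : cis (k%:R * x) = cis x ^+ k.
Proof.
elim: k => [|k IHk]; first by rewrite mul0r cis0.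
by rewrite -natr1 mulrDl mul1r cisD IHk exprSr.
Qed.

(** The frequencies are arbitrary reals and may repeat in the list, so sums and products of
    functions are plain concatenation and pairing of lists. *)
Definition trig_poly (f : R -> C) :=
  exists s : seq (C * R), forall t, f t = \sum_(p <- s) p.1 * cis (p.2 * t).

Lemma trig_poly_ext f g : (forall t, f t = g t) -> trig_poly f -> trig_poly g.
Proof. by move=> fg [s fE]; exists s => t; rewrite -fg. Qed.

Lemma trig_poly_cis a x : trig_poly (fun t => a * cis (x * t)).
Proof. by exists [:: (a, x)] => t; rewrite big_seq1. Qed.

Lemma trig_poly_cst a : trig_poly (fun=> a).
Proof.
by apply: trig_poly_ext (trig_poly_cis a 0) => t; rewrite mul0r cis0 mulr1.
Qed.

Lemma trig_polyD f g : trig_poly f -> trig_poly g -> trig_poly (fun t => f t + g t).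
Proof.
by move=> [s fE] [s' gE]; exists (s ++ s') => t; rewrite big_cat fE gE.
Qed.

Lemma trig_polyM f g : trig_poly f -> trig_poly g -> trig_poly (fun t => f t * g t).
Proof.
move=> [s fE] [s' gE].
exists [seq (p.1 * q.1, p.2 + q.2) | p <- s, q <- s'] => t.
rewrite big_allpairs_dep fE gE mulr_suml; apply: eq_bigr => p _.
by rewrite mulr_sumr; apply: eq_bigr => q _; rewrite /= mulrDl cisD mulrACA.
Qed.

Lemma trig_poly_sum (I : Type) (r : seq I) (f : I -> R -> C) :
  (forall i, trig_poly (f i)) -> trig_poly (fun t => \sum_(i <- r) f i t).
Proof.
move=> f_trig; elim: r => [|i r IHr].
  by apply: trig_poly_ext (trig_poly_cst 0) => t; rewrite big_nil.
by apply: trig_poly_ext (trig_polyD (f_trig i) IHr) => t; rewrite big_cons.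
Qed.

(* Evaluate at the points k * u: if P = \prod_p ('X - z_p) with z_p = cis (p.2 * u),
   then P (z_p) = 0, and solving this for z_p ^-1 expresses f (- u) through the
   values f (k * u) with 0 <= k. *)
Lemma trig_poly_eq0 f :
  trig_poly f -> (forall t, 0 <= t -> f t = 0) -> forall t, f t = 0.
Proof.
move=> [s fE] f0 t; case: (lerP 0 t) => [|t_lt0]; first exact: f0.
pose u := - t; pose z (p : C * R) := cis (p.2 * u).
have fk (k : nat) : \sum_(p <- s) p.1 * z p ^+ k = 0.
  have /f0 : 0 <= k%:R * u by rewrite mulr_ge0 // oppr_ge0 ltW.
  by rewrite fE => fk0; rewrite -[RHS]fk0; apply: eq_bigr => p _; rewrite -cisMn mulrCA.
have ft : f t = \sum_(p <- s) p.1 * (z p)^-1.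
  by rewrite fE; apply: eq_bigr => p _; rewrite -cisN mulrN opprK.
pose P := \prod_(p <- s) ('X - (z p)%:P).
have P0 : P`_0 != 0.
  rewrite -horner_coef0 horner_prod prodf_seq_neq0; apply/allP => p _ /=.
  by rewrite hornerXsubC sub0r oppr_eq0 cis_neq0.
have Pz p : p \in s -> P.[z p] = 0.
  move=> ps; rewrite horner_prod (big_rem p) //= hornerXsubC subrr.
  by rewrite mul0r.
have : \sum_(p <- s) p.1 * (z p)^-1 * P.[z p] = 0.
  by rewrite big_seq big1 // => p /Pz ->; rewrite mulr0.
have : size P = (size P).-1.+1.
  by rewrite prednK // lt0n size_poly_eq0; apply: contraNneq P0 => ->; rewrite coef0.
move: (size P).-1 (erefl (size P)) => N _ sP.
under eq_bigr => p _ do rewrite horner_coef sP mulr_sumr.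
rewrite exchange_big big_ord_recl /= [X in _ + X]big1 => [|i _]; last first.
  under eq_bigr => p _.
    rewrite /bump /= add1n exprS mulrCA -!mulrA mulKf ?cis_neq0 //.
    over.
  by rewrite -mulr_sumr fk mulr0.
under eq_bigr => p _ do rewrite expr0 mulr1.
by rewrite -mulr_suml -ft addr0 => /eqP; rewrite mulf_eq0 (negPf P0) orbF => /eqP.
Qed.

(** * Derivatives of complex and matrix functions of a real variable *)

Definition is_cderive (f : R -> C) (t : R) (df : C) : Prop :=
  is_derive t (1 : R) (fun u => complex.Re (f u)) (complex.Re df) /\
  is_derive t (1 : R) (fun u => complex.Im (f u)) (complex.Im df).

Lemma is_cderive_ext f g t df :
  (forall u, f u = g u) -> is_cderive f t df -> is_cderive g t df.
Proof. by move=> /funext ->. Qed.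

Lemma is_cderive_unique f t df df' :
  is_cderive f t df -> is_cderive f t df' -> df = df'.
Proof.
move=> [fr fi] [fr' fi']; apply/eqP; rewrite eq_complex.
rewrite -(derive_val (is_derive := fr)) -(derive_val (is_derive := fr')).
by rewrite -(derive_val (is_derive := fi)) -(derive_val (is_derive := fi')) !eqxx.
Qed.

Lemma is_cderive_cst a t : is_cderive (fun=> a) t 0.
Proof. by split; apply: is_derive_cst. Qed.

Lemma is_cderiveD f g t df dg : is_cderive f t df -> is_cderive g t dg ->
  is_cderive (fun u => f u + g u) t (df + dg).
Proof.
move=> [fr fi] [gr gi]; split.
- rewrite (_ : (fun _ => _) =
    (fun u => complex.Re (f u)) + (fun u => complex.Re (g u))); last first.
    by apply/funext => u; rewrite /GRing.add /=; case: (f u) (g u) => ? ? [].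
  by apply: is_derive_eq; case: (df) (dg) => ? ? [].
- rewrite (_ : (fun _ => _) =
    (fun u => complex.Im (f u)) + (fun u => complex.Im (g u))); last first.
    by apply/funext => u; rewrite /GRing.add /=; case: (f u) (g u) => ? ? [].
  by apply: is_derive_eq; case: (df) (dg) => ? ? [].
Qed.

Lemma is_cderiveM f g t df dg : is_cderive f t df -> is_cderive g t dg ->
  is_cderive (fun u => f u * g u) t (df * g t + f t * dg).
Proof.
move=> [fr fi] [gr gi]; split.
- rewrite (_ : (fun _ => _) =
    (fun u => complex.Re (f u)) * (fun u => complex.Re (g u)) -
    (fun u => complex.Im (f u)) * (fun u => complex.Im (g u))); last first.
    apply/funext => u; rewrite /= -[RHS]/(_ * _ - _ * _).
    by case: (f u) (g u) => ? ? [].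
  apply: (is_derive_eq (is_deriveB (is_deriveM fr gr) (is_deriveM fi gi)));
    rewrite /GRing.scale /=.
  by case: (df) (dg) (f t) (g t) => a b [c d] [e h] [k l] /=; ring.
- rewrite (_ : (fun _ => _) =
    (fun u => complex.Re (f u)) * (fun u => complex.Im (g u)) +
    (fun u => complex.Im (f u)) * (fun u => complex.Re (g u))); last first.
    apply/funext => u; rewrite /= -[RHS]/(_ * _ + _ * _).
    by case: (f u) (g u) => ? ? [].
  apply: (is_derive_eq (is_deriveD (is_deriveM fr gi) (is_deriveM fi gr)));
    rewrite /GRing.scale /=.
  by case: (df) (dg) (f t) (g t) => a b [c d] [e h] [k l] /=; ring.
Qed.

Lemma is_cderive_sum (I : Type) (r : seq I) (f : I -> R -> C) t df :
  (forall i, is_cderive (f i) t (df i)) ->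
  is_cderive (fun u => \sum_(i <- r) f i u) t (\sum_(i <- r) df i).
Proof.
move=> f_df; elim: r => [|i r IHr].
  rewrite big_nil; apply: is_cderive_ext (is_cderive_cst 0 t) => u.
  by rewrite big_nil.
rewrite big_cons; apply: is_cderive_ext (is_cderiveD (f_df i) IHr) => u.
by rewrite big_cons.
Qed.

Lemma is_cderive_cis x t :
  is_cderive (fun u => cis (x * u)) t (x *i * cis (x * t)).
Proof.
have dx : is_derive t (1 : R) (fun u => x * u) x.
  by apply: is_derive_eq; rewrite /GRing.scale /= mulr1.
split.
- have := is_derive1_comp (is_derive_cos (x * t)) dx.
  by rewrite /cis /comp /= mul0r sub0r mulrC mulrN.
- have := is_derive1_comp (is_derive_sin (x * t)) dx.
  by rewrite /cis /comp /= mul0r add0r mulrC.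
Qed.

(** Termwise differentiation. The derivative is again a trigonometric polynomial, so the lemma can
    be iterated to reach second derivatives. *)
Lemma trig_poly_derive f : trig_poly f ->
  exists2 df, trig_poly df & forall t, is_cderive f t (df t).
Proof.
move=> [s fE].
exists (fun t => \sum_(p <- s) p.1 * (p.2 *i * cis (p.2 * t))) => [|t].
  apply: trig_poly_sum => p; apply: trig_poly_ext (trig_poly_cis (p.1 * p.2 *i) p.2).
  by move=> t; rewrite mulrA.
apply: is_cderive_ext (fun u => esym (fE u)) _.
apply: is_cderive_sum => p.
have := is_cderiveM (is_cderive_cst p.1 t) (is_cderive_cis p.2 t).
by rewrite mul0r add0r.
Qed.

Lemma is_cderive0 f t df : (forall u, f u = 0) -> is_cderive f t df -> df = 0.
Proof.
move=> f0 fdf; apply: (is_cderive_unique fdf).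
by apply: is_cderive_ext (is_cderive_cst 0 t) => u; rewrite f0.
Qed.

Definition is_mxderive m n (A : R -> 'M[C]_(m, n)) t (dA : 'M[C]_(m, n)) :=
  forall i j, is_cderive (fun u => A u i j) t (dA i j).

Definition trig_mx m n (A : R -> 'M[C]_(m, n)) :=
  forall i j, trig_poly (fun t => A t i j).

Lemma is_mxderive_cst m n (A : 'M[C]_(m, n)) t : is_mxderive (fun=> A) t 0.
Proof. by move=> i j; rewrite mxE; apply: is_cderive_cst. Qed.

Lemma is_mxderiveM m n p (A : R -> 'M[C]_(m, n)) (B : R -> 'M[C]_(n, p)) t dA dB :
  is_mxderive A t dA -> is_mxderive B t dB ->
  is_mxderive (fun u => A u *m B u) t (dA *m B t + A t *m dB).
Proof.
move=> AdA BdB i j; rewrite !mxE -big_split /=.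
apply: is_cderive_ext (fun u => esym (mxE _ _ _ _)) _.
by apply: is_cderive_sum => k; apply: is_cderiveM.
Qed.

Lemma is_mxderive_tens m n p q (A : R -> 'M[C]_(m, n)) (B : 'M[C]_(p, q)) t dA :
  is_mxderive A t dA -> is_mxderive (fun u => A u *t B) t (dA *t B).
Proof.
move=> AdA i j; rewrite mxE; apply: is_cderive_ext (fun u => esym (mxE _ _ _ _)) _.
have := is_cderiveM (AdA (mxtens_unindex i).1 (mxtens_unindex j).1)
  (is_cderive_cst (B (mxtens_unindex i).2 (mxtens_unindex j).2) t).
by rewrite mulr0 addr0.
Qed.

Lemma trig_mx_cst m n (A : 'M[C]_(m, n)) : trig_mx (fun=> A).
Proof. by move=> i j; apply: trig_poly_cst. Qed.

Lemma trig_mxM m n p (A : R -> 'M[C]_(m, n)) (B : R -> 'M[C]_(n, p)) :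
  trig_mx A -> trig_mx B -> trig_mx (fun t => A t *m B t).
Proof.
move=> tA tB i j; apply: trig_poly_ext (fun t => esym (mxE _ _ _ _)) _.
by apply: trig_poly_sum => k; apply: trig_polyM.
Qed.

Lemma trig_mx_tens m n p q (A : R -> 'M[C]_(m, n)) (B : 'M[C]_(p, q)) :
  trig_mx A -> trig_mx (fun t => A t *t B).
Proof.
move=> tA i j; apply: trig_poly_ext (fun t => esym (mxE _ _ _ _)) _.
by apply: trig_polyM => //; apply: trig_poly_cst.
Qed.

End TrigonometricPolynomials.

(** * The evolution operator through the spectral theorem *)

Section UnitaryEvolution.
Local Open Scope sesquilinear_scope.
Variable R : realType.
Local Notation C := R[i].

(** Links the exponential series of - i x to the series that define cosine and sine: even powers are
    real, odd powers imaginary. *)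
Lemma exprNi (x : R) k : (0 -i* x) ^+ k =
  (k`!%:R * cos_coeff x k) -i* (k`!%:R * sin_coeff x k) :> C.
Proof.
have k0 (j : nat) : j`!%:R != 0 :> R by rewrite pnatr_eq0 -lt0n fact_gt0.
have -> : k`!%:R * cos_coeff x k = (~~ odd k)%:R * (-1) ^+ k./2 * x ^+ k.
  by rewrite /cos_coeff /= mulrCA divff // mulr1.
have -> : k`!%:R * sin_coeff x k = (odd k)%:R * (-1) ^+ k.-1./2 * x ^+ k.
  by rewrite /sin_coeff /= mulrCA divff // mulr1.
elim: k => [|k IHk].
  by rewrite !expr0 /= !mul0r !mul1r oppr0.
rewrite exprS IHk /=; simpc; rewrite uphalf_half.
have [ok|ek] := boolP (odd k) => /=.
  have -> : k./2 = k.-1./2.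
    by case: (k) ok => //= k' /negPf ok; rewrite uphalf_half ok.
  by rewrite !exprS; congr Complex; ring.
by rewrite !exprS; congr Complex; ring.
Qed.

Lemma limn_series_eq (u : nat -> R) l : series u @ \oo --> l -> limn (series u) = l.
Proof. exact: cvg_lim. Qed.

Lemma cvg_sum_seq (I : Type) (r : seq I) (u : I -> R ^nat) (l : I -> R) :
  (forall i, u i @ \oo --> l i) ->
  (fun n => \sum_(i <- r) u i n) @ \oo --> \sum_(i <- r) l i.
Proof.
move=> ul; elim: r => [|i r IHr].
  rewrite big_nil (_ : (fun _ => _) = cst 0); first exact: cvg_cst.
  by apply/funext => n; rewrite big_nil.
rewrite big_cons (_ : (fun _ => _) = u i \+ (fun n => \sum_(j <- r) u j n)).
  exact: cvgD.
by apply/funext => n; rewrite big_cons.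
Qed.

(** The real and imaginary parts of the entries of the exponential of a diagonalized matrix reduce
    to series of this shape. *)
Lemma cvg_series_cos_sin m (b e x : 'I_m -> R) :
  series (fun k => \sum_l (b l * cos_coeff (x l) k + e l * sin_coeff (x l) k)) @ \oo
    --> \sum_l (b l * cos (x l) + e l * sin (x l)).
Proof.
have cvg_cos (y : R) : series (cos_coeff y) @ \oo --> cos y.
  by rewrite cos.unlock; apply: is_cvg_series_cos_coeff.
have cvg_sin (y : R) : series (sin_coeff y) @ \oo --> sin y.
  by rewrite sin.unlock; apply: is_cvg_series_sin_coeff.
rewrite (_ : series _ = (fun n => \sum_l
  (b l * series (cos_coeff (x l)) n + e l * series (sin_coeff (x l)) n))).
  apply: cvg_sum_seq => l.
  have cl : b l \*: series (cos_coeff (x l)) @ \oo --> b l * cos (x l).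
    exact: cvgZl_tmp.
  have sl : e l \*: series (sin_coeff (x l)) @ \oo --> e l * sin (x l).
    exact: cvgZl_tmp.
  exact: cvgD cl sl.
apply/funext => n; rewrite /series /= exchange_big; apply: eq_bigr => l _.
by rewrite big_split /= -!mulr_sumr.
Qed.

Lemma mulmx_diagE m n p (P : 'M[C]_(m, n)) (d : 'rV_n) (Q : 'M[C]_(n, p)) i j :
  (P *m diag_mx d *m Q) i j = \sum_l P i l * Q l j * d 0 l.
Proof.
by rewrite mul_mx_diag mxE; apply: eq_bigr => l _; rewrite mxE mulrAC.
Qed.

(** Powers of a diagonalized matrix are diagonalized by the same [P] and [Q], so each entry of the
    series is a finite combination of scalar exponential series. [expmx] takes limits that are
    defined without regard to convergence; the convergence is established here. *)
Lemma expmx_diag m (P Q : 'M[C]_m) (x : 'I_m -> R) : Q *m P = 1%:M ->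
  P *m Q = 1%:M ->
  expmx (P *m diag_mx (\row_l (0 -i* x l)) *m Q) =
    P *m diag_mx (\row_l cis (- x l)) *m Q.
Proof.
move=> QP PQ; set A := P *m _ *m Q.
have AX k : A ^+ k = P *m diag_mx (\row_l (0 -i* x l) ^+ k) *m Q.
  elim: k => [|k IHk].
    rewrite expr0 -[LHS]PQ; congr (_ *m _); rewrite -[LHS]mulmx1; congr (_ *m _).
    by apply/matrixP => i j; rewrite !mxE.
  rewrite exprS IHk -[LHS]/(A *m _) /A -!mulmxA (mulmxA Q P) QP mul1mx.
  rewrite (mulmxA (diag_mx _) (diag_mx _)) mulmx_diag.
  by congr (_ *m (diag_mx _ *m _)); apply/rowP => l; rewrite !mxE exprS.
apply/matrixP => i j; rewrite mxE mulmx_diagE.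
pose a l := P i l * Q l j.
have AXE k : (A ^+ k) i j = \sum_l a l * (0 -i* x l) ^+ k.
  by rewrite AX mulmx_diagE; apply: eq_bigr => l _; rewrite mxE.
have k0 (k : nat) : k`!%:R != 0 :> R by rewrite pnatr_eq0 -lt0n fact_gt0.
(* With a l = u + i v, the product with exp(- i x) has real part u cos x + v sin x and imaginary
   part v cos x - u sin x. *)
rewrite (@limn_series_eq _
  (\sum_l (complex.Re (a l) * cos (x l) + complex.Im (a l) * sin (x l)))).
rewrite (@limn_series_eq _
  (\sum_l (complex.Im (a l) * cos (x l) + (- complex.Re (a l)) * sin (x l)))).
- apply/eqP; rewrite eq_complex (raddf_sum (@complex.Re R : Rcomplex R -> R)) /=.
  rewrite (raddf_sum (@complex.Im R : Rcomplex R -> R)) /=.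
  apply/andP; split; apply/eqP; apply: eq_bigr => l _; rewrite mxE /cis cosN sinN.
    by rewrite -/(a l); case: (a l) => u v /=; ring.
  by rewrite -/(a l); case: (a l) => u v /=; ring.
- rewrite (_ : (fun _ => _) = (fun k => \sum_l (complex.Im (a l) * cos_coeff (x l) k
      + (- complex.Re (a l)) * sin_coeff (x l) k))).
    exact: cvg_series_cos_sin.
  apply/funext => k; rewrite AXE (raddf_sum (@complex.Im R : Rcomplex R -> R)) /=.
  rewrite mulr_suml; apply: eq_bigr => l _; rewrite exprNi.
  by case: (a l) => u v /=; field.
- rewrite (_ : (fun _ => _) = (fun k => \sum_l (complex.Re (a l) * cos_coeff (x l) k
      + complex.Im (a l) * sin_coeff (x l) k))).
    exact: cvg_series_cos_sin.
  apply/funext => k; rewrite AXE (raddf_sum (@complex.Re R : Rcomplex R -> R)) /=.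
  rewrite mulr_suml; apply: eq_bigr => l _; rewrite exprNi.
  by case: (a l) => u v /=; field.
Qed.

Lemma hermitian_opP m (H : 'M[C]_m) : hermitian_op H -> H \is hermsymmx.
Proof. by move=> HH; apply/is_hermitianmxP; rewrite expr0 scale1r; rewrite HH. Qed.

Lemma hermitian_opN m (H : 'M[C]_m) : hermitian_op H -> hermitian_op (- H).
Proof. by rewrite /hermitian_op => HH; rewrite linearN map_mxN HH. Qed.

(** The spectral theorem, with eigenvalues given as elements of [R] so that they can serve as
    frequencies. *)
Lemma hermitian_spectral m (H : 'M[C]_m) : hermitian_op H ->
  exists (S : 'M[C]_m) (x : 'I_m -> R),
    [/\ S *m S ^t* = 1%:M, S ^t* *m S = 1%:M &
        H = S ^t* *m diag_mx (\row_l (x l)%:C) *m S].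
Proof.
move/hermitian_opP => H_herm.
have /orthomx_spectralP := hermitian_normalmx H_herm.
have := hermitian_spectral_diag_real H_herm.
have := spectral_unitarymx H.
move: (spectralmx H) (spectral_diag H) => S d S_unitary d_real HE.
have SSC : S *m S ^t* = 1%:M by apply/unitarymxP.
have dE : d = \row_l (complex.Re (d 0 l))%:C.
  by apply/rowP => l; rewrite mxE RRe_real // (mxOverP d_real).
exists S, (fun l => complex.Re (d 0 l)); split; [exact: SSC|exact: mulmx1C|].
by rewrite -dE -(invmx_unitary S_unitary).
Qed.

Lemma evolution_diag m (P Q : 'M[C]_m) (x : 'I_m -> R) t :
  Q *m P = 1%:M -> P *m Q = 1%:M ->
  evolution (P *m diag_mx (\row_l (x l)%:C) *m Q) t =
    P *m diag_mx (\row_l cis (- (x l * t))) *m Q.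
Proof.
move=> QP PQ; rewrite -(expmx_diag _ QP PQ) /evolution; congr expmx.
rewrite scalemxAl scalemxAr; congr (_ *m _ *m _).
apply/matrixP => i j; rewrite !mxE mulrnAr.
by congr (_ *+ _); simpc; rewrite mulrC.
Qed.

Section Hermitian.
Variables (m : nat) (H : 'M[C]_m).
Hypothesis H_herm : hermitian_op H.

(** In an eigenbasis the entries are combinations of exp(- i x t), with x running over the
    eigenvalues of [H]. *)
Lemma trig_mx_evolution : trig_mx (evolution H).
Proof.
have [S [x [SSC SCS ->]]] := hermitian_spectral H_herm.
have evE t := evolution_diag x t SSC SCS.
move=> i j; apply: (@trig_poly_ext _ (fun t => \sum_l
  S^t* i l * S l j * cis (- x l * t))) => [t|].
  rewrite evE mulmx_diagE; apply: eq_bigr => l _.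
  by rewrite /= [X in _ = _ * X]mxE mulNr.
by apply: trig_poly_sum => l; apply: trig_poly_cis.
Qed.

Lemma trmxC_evolution t : (evolution H t) ^t* = evolution H (- t).
Proof.
have [S [x [SSC SCS ->]]] := hermitian_spectral H_herm.
rewrite !(evolution_diag x _ SSC SCS) !trmxC_mul trmxCK -mulmxA.
congr (_ *m (_ *m _)); apply/matrixP => i j; rewrite !mxE.
rewrite eq_sym; case: eqP => [->|_]; last by rewrite !mulr0n raddf0.
by rewrite !mulr1n conj_cis mulrN.
Qed.

Lemma evolution_unitary t : (evolution H t) ^t* *m evolution H t = 1%:M.
Proof.
rewrite trmxC_evolution; have [S [x [SSC SCS ->]]] := hermitian_spectral H_herm.
rewrite !(evolution_diag x _ SSC SCS) -!mulmxA (mulmxA S) SSC mul1mx.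
rewrite (mulmxA (diag_mx _) (diag_mx _)) mulmx_diag.
rewrite (_ : diag_mx _ = 1%:M) ?mul1mx //; apply/matrixP => i j; rewrite !mxE.
by rewrite -cisD mulrN opprK subrr cis0.
Qed.

Lemma evolution0 : evolution H 0 = 1%:M.
Proof.
have [S [x [SSC SCS ->]]] := hermitian_spectral H_herm.
rewrite (evolution_diag x _ SSC SCS) (_ : diag_mx _ = 1%:M) ?mulmx1 //.
by apply/matrixP => i j; rewrite !mxE mulr0 oppr0 cis0.
Qed.

Lemma is_mxderive_evolution0 : is_mxderive (evolution H) 0 ((0 -i* 1) *: H).
Proof.
have [S [x [SSC SCS ->]]] := hermitian_spectral H_herm.
have evE t := evolution_diag x t SSC SCS.
move=> i j; apply: (@is_cderive_ext _ (fun t => \sum_l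
  S^t* i l * S l j * cis (- x l * t))) => [t|].
  rewrite evE mulmx_diagE; apply: eq_bigr => l _.
  by rewrite /= [X in _ = _ * X]mxE mulNr.
rewrite mxE mulmx_diagE mulr_sumr.
apply: is_cderive_sum => l; rewrite [X in is_cderive _ _ (_ * (_ * X))]mxE.
have := is_cderiveM (is_cderive_cst (S^t* i l * S l j) 0) (is_cderive_cis (- x l) 0).
rewrite mul0r add0r mulr0 cis0 mulr1.
rewrite (_ : (0 -i* 1) * _ = S^t* i l * S l j * (- x l) *i) //.
by rewrite mulrCA; congr (_ * _); simpc; rewrite ?mul1r.
Qed.

End Hermitian.

(** Trades time reversal for a sign of the Hamiltonian, so that facts on [evolution] transfer to
    reversed time. *)
Lemma evolutionN m (H : 'M[C]_m) t : evolution H (- t) = evolution (- H) t.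
Proof.
have tN : 0 -i* (- t) = - (0 -i* t) :> C.
  by apply/eqP; rewrite eq_complex /= oppr0 !eqxx.
by rewrite /evolution tN scaleNr scalerN.
Qed.

End UnitaryEvolution.

(** * Fidelity against a pure state, and the partial trace *)

Section Fidelity.
Local Open Scope sesquilinear_scope.
Variable R : realType.
Local Notation C := R[i].

(* Every eigenvalue of c *: P is 0 or c. *)
Lemma sqrtmx_scaled_projector m (c : C) (P : 'M[C]_m) :
  P ^t* = P -> P *m P = P -> sqrtmx (c *: P) = sqrtC c *: P.
Proof.
move=> PC PP; set A := c *: P.
have A_normal : A \is normalmx.
  apply/normalmxP; rewrite /A linearZ /= map_mxZ PC.
  by rewrite -!scalemxAl -!scalemxAr !scalerA mulrC.
have := orthomx_spectralP A_normal; have := spectral_unit A.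
rewrite /sqrtmx; move: (spectralmx A) (spectral_diag A) => S d S_unit AE.
have SAS : S *m A *m invmx S = diag_mx d.
  by rewrite [in LHS]AE !mulmxA mulmxV // mul1mx -mulmxA mulmxV // mulmx1.
have dd l : d 0 l * d 0 l = c * d 0 l.
  have : diag_mx d *m diag_mx d = c *: diag_mx d.
    rewrite -SAS -!mulmxA (mulmxA (invmx S)) mulVmx // mul1mx (mulmxA A A).
    have -> : A *m A = c *: A by rewrite {1 2}/A -scalemxAl -scalemxAr PP.
    by rewrite -scalemxAl -scalemxAr.
  by rewrite mulmx_diag => /matrixP /(_ l l); rewrite !mxE eqxx !mulr1n.
have d0c l : d 0 l = 0 \/ d 0 l = c.
  have [->|d0] := eqVneq (d 0 l) 0; first by left.
  by right; apply: (mulIf d0).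
have sq : sqrtC c *: (invmx S *m diag_mx (map_mx sqrtC d) *m S) = c *: P.
  rewrite -/A AE -[in RHS]mulmxA scalemxAl scalemxAr -mulmxA.
  congr (_ *m (_ *m _)); apply/matrixP => i j; rewrite !mxE mulrnAr.
  congr (_ *+ _); have [->|->] := d0c i; first by rewrite sqrtC0 mulr0.
  by rewrite -expr2 sqrtCK.
have [c0|c0] := eqVneq c 0.
  rewrite c0 sqrtC0 scale0r (_ : diag_mx _ = 0) ?mulmx0 ?mul0mx //.
  apply/matrixP => i j; rewrite !mxE.
  by have [->|->] := d0c i; rewrite ?c0 sqrtC0 mul0rn.
apply: (@scalerI _ _ (sqrtC c)); first by rewrite sqrtC_eq0.
by rewrite sq scalerA -expr2 sqrtCK.
Qed.

(** The projector P onto [v] is its own square root, and P eta P = c P with c the expectation of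
    [eta] in [v]. The square root of c P is sqrt(c) P, of trace sqrt(c), whose square is c. *)
Lemma fidelity_pure m (v : 'cV[C]_m) (eta : 'M[C]_m) : unit_vector v ->
  fidelity (proj_ket v) eta = (v ^t* *m eta *m v) 0 0.
Proof.
move=> v1; set P := proj_ket v; set c := (_ *m v) 0 0.
have PC : P ^t* = P by rewrite /P /proj_ket trmxC_mul trmxCK.
have PP : P *m P = P by rewrite /P /proj_ket mulmxA -(mulmxA v) v1 mulmx1.
have sqP : sqrtmx P = P.
  by rewrite -[P in LHS]scale1r sqrtmx_scaled_projector // sqrtC1 scale1r.
have PeP : P *m eta *m P = c *: P.
  rewrite /P /proj_ket !mulmxA -(mulmxA v) -(mulmxA v).
  by rewrite (mx11_scalar (v ^t* *m eta *m v)) -/c mul_mx_scalar -scalemxAl.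
have trP : \tr P = 1.
  by rewrite /P /proj_ket mxtrace_mulC v1 mxtrace1.
by rewrite /fidelity sqP PeP sqrtmx_scaled_projector // mxtraceZ trP mulr1 sqrtCK.
Qed.

Lemma ptraceB_expectation m d (v : 'cV[C]_m) (y : 'cV[C]_(m * d)) :
  (v ^t* *m ptraceB (y *m y ^t*) *m v) 0 0 =
  (sqnorm (((v ^t* : 'rV[C]_m) *t (1%:M : 'M[C]_d)) *m y))%:C.
Proof.
(* The amplitude of [y] on [v] tensored with the bath basis vector [k]; both sides equal the sum of
   the squared moduli of these amplitudes. *)
pose w k := \sum_i Num.conj (v i 0) * y (mxtens_index (i, k)) 0.
transitivity (\sum_k Num.conj (w k) * w k).
  rewrite !mxE.
  have -> : \sum_j (v ^t* *m ptraceB (y *m y ^t*)) 0 j * v j 0 =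
      \sum_j \sum_i \sum_k Num.conj (v i 0) * y (mxtens_index (i, k)) 0 *
        (v j 0 * Num.conj (y (mxtens_index (j, k)) 0)).
    apply: eq_bigr => j _; rewrite !mxE mulr_suml; apply: eq_bigr => i _.
    rewrite !mxE mulr_sumr mulr_suml; apply: eq_bigr => k _.
    by rewrite !mxE big_ord1 !mxE; ring.
  under eq_bigr => j _ do rewrite exchange_big.
  rewrite exchange_big /=; apply: eq_bigr => k _.
  rewrite rmorph_sum /= mulr_suml; apply: eq_bigr => j _.
  rewrite /w mulr_sumr; apply: eq_bigr => i _.
  by rewrite rmorphM /= conjCK mulrC.
rewrite /sqnorm rmorph_sum sum_mxtens_index big_ord1 /=; apply: eq_bigr => k _.
rewrite cnorm2E mxE sum_mxtens_index.
suff -> : \sum_i \sum_j ((v ^t* : 'rV[C]_m) *t (1%:M : 'M[C]_d)) (mxtens_index (0, k))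
    (mxtens_index (i, j)) * y (mxtens_index (i, j)) 0 = w k by [].
apply: eq_bigr => i _; rewrite (bigD1 k) //= big1 ?addr0 => [|j jk].
  by rewrite tensmxE !mxE eqxx mulr1.
by rewrite tensmxE !mxE eq_sym (negPf jk) mulr0 mul0r.
Qed.

(** Pythagoras: under the hypothesis, the product of the adjoint of [A] with [A] is an orthogonal
    projector, and [A] preserves norms on its range. *)
Lemma sqnorm_proj_compl p n (A : 'M[C]_(p, n)) (y : 'cV_n) :
  A *m A ^t* = 1%:M ->
  sqnorm (y - A ^t* *m (A *m y)) = sqnorm y - sqnorm (A *m y).
Proof.
move=> AA; set B := A ^t*; set u := y - _.
have uu : u ^t* *m u = y ^t* *m y - (A *m y) ^t* *m (A *m y).
  have -> : u ^t* = y ^t* - y ^t* *m B *m A.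
    by rewrite linearB map_mxB !trmxC_mul trmxCK.
  rewrite trmxC_mul mulmxBl !mulmxBr -/B !mulmxA -(mulmxA _ A B) AA mulmx1.
  by rewrite [X in _ - X]subrr subr0.
apply: complexI; move: uu; rewrite !sqnormE => /matrixP /(_ 0 0).
by rewrite !mxE /= !mulr1n rmorphB.
Qed.

Lemma reduced_stateE m d (H : 'M[C]_(m * d)) (psi : 'cV[C]_m)
    (phi : 'cV[C]_d) t : hermitian_op H ->
  let y := evolution H t *m (psi *t phi : 'cV[C]_(m * d)) in
  reduced_state H psi phi t = ptraceB (y *m y ^t*).
Proof.
by move=> HH /=; rewrite /reduced_state -trmxC_evolution // /proj_ket trmxC_mul !mulmxA.
Qed.

Lemma evolved_proj_ket m (H : 'M[C]_m) (psi : 'cV[C]_m) t : hermitian_op H ->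
  evolution H t *m proj_ket psi *m evolution H (- t) =
    proj_ket (evolution H t *m psi).
Proof.
by move=> HH; rewrite -trmxC_evolution // /proj_ket trmxC_mul !mulmxA.
Qed.

Lemma trig_mx_evolutionN m (H : 'M[C]_m) : hermitian_op H ->
  trig_mx (fun t => evolution H (- t)).
Proof.
move=> HH i j; apply: trig_poly_ext (trig_mx_evolution (hermitian_opN HH) i j) => t.
by rewrite evolutionN.
Qed.

(** The difference of the two sides is entrywise a trigonometric polynomial vanishing for t >= 0, so
    [trig_poly_eq0] applies. *)
Lemma decoherence_free_all_times m d (HS : 'M[C]_m) (H0 : 'M[C]_(m * d)) phi D psi :
  hermitian_op HS -> hermitian_op H0 -> decoherence_free HS H0 phi D ->
  psi \in D -> unit_vector psi ->
  forall t, reduced_state H0 psi phi t = proj_ket (evolution HS t *m psi).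
Proof.
move=> HSh H0h dfs psiD psi1 t; rewrite -evolved_proj_ket //.
apply/matrixP => i j; apply/eqP; rewrite -subr_eq0; apply/eqP; move: t.
apply: trig_poly_eq0 => [|t t0]; last first.
  by have [-> _] := dfs psi t psiD psi1 t0; rewrite subrr.
have tr1 : trig_poly (fun t => reduced_state H0 psi phi t i j).
  apply: trig_poly_ext (fun t => esym (mxE _ _ _ _)) _.
  apply: trig_poly_sum => k; apply: trig_mxM (trig_mx_evolutionN H0h) _ _.
  by apply: trig_mxM (trig_mx_evolution H0h) (trig_mx_cst _).
have tr2 : trig_poly (fun t =>
    -1 * (evolution HS t *m proj_ket psi *m evolution HS (- t)) i j).
  apply: trig_polyM (trig_poly_cst _) _; move: i j {tr1}.
  by apply: trig_mxM (trig_mx_evolutionN HSh);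
    apply: trig_mxM (trig_mx_evolution HSh) (trig_mx_cst _).
by apply: trig_poly_ext (trig_polyD tr1 tr2) => t; rewrite mulN1r.
Qed.

(** * The second derivative of a squared norm at a zero *)

Lemma is_derive_sum_fun n (f : 'I_n -> R -> R) t (df : 'I_n -> R) :
  (forall i, is_derive t (1 : R) (f i) (df i)) ->
  is_derive t (1 : R) (fun u => \sum_i f i u) (\sum_i df i).
Proof.
move=> fdf; rewrite (_ : (fun _ => _) = \sum_i f i); first exact: is_derive_sum.
by apply/funext => u; rewrite fct_sumE.
Qed.

Lemma derive1_eq (f df : R -> R) :
  (forall t, is_derive t (1 : R) f (df t)) -> derive1 f = df.
Proof. by move=> fdf; apply/funext => t; rewrite derive1E derive_val. Qed.

(** The second derivative is - 2 times the sum of |z'| ^ 2 + Re(conj(z) z'') over the entries. The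
    second summand vanishes with z at 0, so z'' must exist but its value is irrelevant; existence
    comes from [trig_mx z]. *)
Lemma derive1n2_sqnorm n (z : R -> 'cV[C]_n) dz : trig_mx z -> z 0 = 0 ->
  is_mxderive z 0 dz ->
  derive1n 2 (fun t => 1 - sqnorm (z t)) 0 = - 2 * sqnorm dz.
Proof.
move=> z_trig z0 zdz.
have /choice [z' z'P] : forall i, exists df, trig_poly df /\
    forall t, is_cderive (fun u => z u i 0) t (df t).
  by move=> i; have [df] := trig_poly_derive (z_trig i 0); exists df.
have /choice [z'' z''P] : forall i, exists df : R -> C,
    forall t, is_cderive (z' i) t (df t).
  by move=> i; have [df _ ?] := trig_poly_derive (z'P i).1; exists df.
have z'0 i : z' i 0 = dz i 0 by apply: is_cderive_unique ((z'P i).2 0) (zdz i 0).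
pose re (w : R -> C) u := complex.Re (w u); pose im (w : R -> C) u := complex.Im (w u).
pose zz i u := z u i 0.
have dF t : is_derive t (1 : R) (fun t => 1 - sqnorm (z t))
    (- \sum_i 2 * (re (zz i) t * re (z' i) t + im (zz i) t * im (z' i) t)).
  rewrite -sub0r.
  apply: is_deriveB; apply: is_derive_sum_fun => i.
  have [dr di] := (z'P i).2 t.
  rewrite (_ : (fun _ => _) = re (zz i) * re (zz i) + im (zz i) * im (zz i)).
    apply: (is_derive_eq (is_deriveD (is_deriveM dr dr) (is_deriveM di di))).
    by rewrite /GRing.scale /= /re /im /zz; ring.
  apply/funext => u.
  by rewrite /cnorm2 !expr2
    -[RHS]/(re (zz i) u * re (zz i) u + im (zz i) u * im (zz i) u).
rewrite derive1nS derive1n1 (derive1_eq dF) derive1E; apply: derive_val.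
rewrite mulNr; apply: is_deriveN; rewrite mulr_sumr.
apply: is_derive_sum_fun => i.
have [dr di] := (z'P i).2 0; have [dr' di'] := z''P i 0.
rewrite (_ : (fun _ => _) = cst 2 * (re (zz i) * re (z' i) + im (zz i) * im (z' i))).
  apply: (is_derive_eq (is_deriveM (is_derive_cst _ _ _)
    (is_deriveD (is_deriveM dr dr') (is_deriveM di di')))).
  by rewrite z'0 z0 mxE /=; rewrite /GRing.scale /= /cnorm2; ring.
apply/funext => u.
by rewrite -[RHS]/(2 * (re (zz i) u * re (z' i) u + im (zz i) u * im (z' i) u)).
Qed.

End Fidelity.

(** * The susceptibility as a leakage norm *)

Section Susceptibility.
Local Open Scope sesquilinear_scope.
Variables (R : realType) (m d : nat).
Local Notation C := R[i].
Variables (HS : 'M[C]_m) (H0 V : 'M[C]_(m * d)).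
Variables (phi : 'cV[C]_d) (D : {vspace 'cV[C]_m}) (psi : 'cV[C]_m).
Hypotheses (HS_herm : hermitian_op HS) (H0_herm : hermitian_op H0).
Hypotheses (V_herm : hermitian_op V) (phi1 : unit_vector phi).
Hypotheses (dfs : decoherence_free HS H0 phi D) (psiD : psi \in D).
Hypothesis psi1 : unit_vector psi.

Let Psi : 'cV[C]_(m * d) := psi *t phi.
(** Contraction of the system factor with the bra of psi. Its adjoint times [A] is the projector
    onto psi (x) (bath space), and [N] is the complementary projector. *)
Let A : 'M[C]_(1 * d, m * d) := (psi ^t* : 'rV[C]_m) *t 1%:M.
Let N : 'M[C]_(m * d) := 1%:M - A ^t* *m A.

Let AC : A ^t* = psi *t (1%:M : 'M[C]_d).
Proof. by rewrite /A trmxC_tens trmxCK trmxC1. Qed.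

Let AA : A *m A ^t* = 1%:M.
Proof. by rewrite AC /A tensmx_mul psi1 mulmx1 tensmx11. Qed.

Let NPsi : N *m Psi = 0.
Proof.
rewrite /N mulmxBl mul1mx -mulmxA AC.
have -> : A *m Psi = (1%:M : 'M[C]_1) *t phi.
  rewrite -[LHS]/(((psi ^t* : 'rV[C]_m) *t 1%:M) *m (psi *t phi)).
  by rewrite tensmx_mul psi1 mul1mx.
rewrite [X in _ - X](_ : _ = Psi) ?subrr //.
by rewrite -[LHS]/((psi *t 1%:M) *m (1%:M *t phi)) tensmx_mul mulmx1 mul1mx.
Qed.

Let NE (u : 'cV[C]_(m * d)) : N *m u = u - A ^t* *m (A *m u).
Proof. by rewrite /N mulmxBl mul1mx -mulmxA. Qed.

Let Psi1 : sqnorm Psi = 1.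
Proof. by rewrite sqnorm_tens !sqnorm_unit // mulr1. Qed.

(** The vector y(t) of the overview for a Hamiltonian [H]; the factor exp(i t HS) is
    [evolution HS (- t)]. *)
Let comoving (H : 'M[C]_(m * d)) t : 'cV[C]_(m * d) :=
  (evolution HS (- t) *t 1%:M) *m (evolution H t *m Psi).

Let perturbed_herm eps : hermitian_op (H0 + eps%:C *: V).
Proof.
rewrite /hermitian_op linearD linearZ /= map_mxD map_mxZ H0_herm V_herm.
by congr (_ + _ *: _); apply: conjc_real.
Qed.

Let sqnorm_comoving H t : hermitian_op H -> sqnorm (comoving H t) = 1.
Proof.
move=> H_herm; rewrite sqnorm_isometry.
  by rewrite sqnorm_isometry ?evolution_unitary ?Psi1.
rewrite trmxC_tens trmxC_evolution // opprK tensmx_mul trmxC1 mulmx1.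
by rewrite -(trmxC_evolution HS_herm) (mulmx1C (evolution_unitary HS_herm t)) tensmx11.
Qed.

Let unit_evolved t : unit_vector (evolution HS t *m psi).
Proof.
by rewrite /unit_vector trmxC_mul -mulmxA (mulmxA _ (evolution _ _))
  evolution_unitary // mul1mx psi1.
Qed.

Let unperturbedE t :
  perturbed_state H0 V psi phi 0 t = proj_ket (evolution HS t *m psi).
Proof.
rewrite /perturbed_state scale0r addr0.
exact: decoherence_free_all_times dfs psiD psi1 t.
Qed.

(** Moving exp(- i t HS) from the bra to the state turns contraction with the evolved psi into [A]
    acting on the comoving vector. That vector has norm 1, so Pythagoras trades [A] for [N]. *)
Let dyn_fidelityE eps t : dyn_fidelity H0 V psi phi eps t =
  1 - sqnorm (N *m comoving (H0 + eps%:C *: V) t).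
Proof.
have H_herm := perturbed_herm eps; set H := H0 + _ in H_herm *.
have comovingE :
    (((evolution HS t *m psi) ^t* : 'rV[C]_m) *t 1%:M) *m (evolution H t *m Psi) =
    A *m comoving H t.
  rewrite /comoving -(trmxC_evolution HS_herm) (mulmxA A) /A.
  by rewrite tensmx_mul trmxC_mul mulmx1.
rewrite NE (sqnorm_proj_compl _ AA) (sqnorm_comoving _ H_herm) subKr.
rewrite /dyn_fidelity unperturbedE (fidelity_pure _ (unit_evolved t)).
rewrite /perturbed_state -/H (reduced_stateE _ _ _ H_herm) ptraceB_expectation /=.
by rewrite -/Psi comovingE.
Qed.

Let comoving_trig H : hermitian_op H -> trig_mx (fun t => N *m comoving H t).
Proof.
move=> H_herm; apply: trig_mxM (trig_mx_cst _) _.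
apply: trig_mxM; last exact: trig_mxM (trig_mx_evolution H_herm) (trig_mx_cst _).
apply: (@trig_mx_tens _ _ _ _ _ (fun t => evolution HS (- t))).
exact: trig_mx_evolutionN.
Qed.

Let comoving0 H : hermitian_op H -> comoving H 0 = Psi.
Proof.
by move=> H_herm; rewrite /comoving oppr0 !evolution0 // tensmx11 !mul1mx.
Qed.

(** Product rule at t = 0, where both evolutions are the identity: one factor contributes i HS (x)
    1, the other - i H. *)
Let comoving_derive H : hermitian_op H ->
  is_mxderive (fun t => N *m comoving H t) 0
    (N *m ((0 -i* 1) *: (H - HS *t 1%:M) *m Psi)).
Proof.
move=> H_herm.
have dW : is_mxderive (fun t => evolution HS (- t)) 0 ((0 -i* 1) *: - HS).
  move=> i j.
  apply: is_cderive_ext (is_mxderive_evolution0 (hermitian_opN HS_herm) i j).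
  by move=> t; rewrite -evolutionN.
have dU : is_mxderive (fun t => evolution H t *m Psi) 0 ((0 -i* 1) *: H *m Psi).
  rewrite -[_ *m Psi]addr0 -[X in _ + X](mulmx0 _ (evolution H 0)).
  exact: is_mxderiveM (is_mxderive_evolution0 H_herm) (is_mxderive_cst Psi 0).
have dT : is_mxderive (fun t => evolution HS (- t) *t (1%:M : 'M[C]_d)) 0
    (((0 -i* 1) *: - HS) *t 1%:M).
  exact: (@is_mxderive_tens _ _ _ _ _ (fun t => evolution HS (- t)) 1%:M 0 _ dW).
have dC : is_mxderive (comoving H) 0 ((0 -i* 1) *: (H - HS *t 1%:M) *m Psi).
  rewrite (_ : _ *m Psi = ((0 -i* 1) *: - HS) *t 1%:M *m (evolution H 0 *m Psi) +
    (evolution HS (- 0) *t 1%:M) *m ((0 -i* 1) *: H *m Psi)).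
    exact: (@is_mxderiveM _ _ _ _ (fun t => evolution HS (- t) *t (1%:M : 'M[C]_d))
      (fun t => evolution H t *m Psi) 0 _ _ dT dU).
  rewrite oppr0 !evolution0 // tensmx11 !mul1mx tensmxZl -mulmxDl -scalerDr.
  rewrite [- HS *t _ + _]addrC; congr (_ *: (_ + _) *m _).
  by apply/matrixP => i j; rewrite !mxE mulNr.
rewrite -[N *m _]add0r -[X in X + _](mul0mx _ (comoving H 0)).
exact: (@is_mxderiveM _ _ _ _ (fun=> N) (comoving H) 0 _ _ (is_mxderive_cst N 0) dC).
Qed.

(** At eps = 0 the fidelity compares a pure state with itself and equals 1. Hence [N] annihilates
    the comoving vector at all times, and its derivative at 0 as well. *)
Let unperturbed_leak0 :
  N *m ((0 -i* 1) *: (H0 - HS *t 1%:M) *m Psi) = 0.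
Proof.
have pure (v : 'cV[C]_m) : unit_vector v -> (v ^t* *m proj_ket v *m v) 0 0 = 1.
  by move=> v1; rewrite /proj_ket mulmxA v1 mul1mx v1 mxE.
have leak0 t : N *m comoving H0 t = 0.
  apply: sqnorm_eq0; have := dyn_fidelityE 0 t.
  rewrite scale0r addr0 /dyn_fidelity unperturbedE.
  rewrite (fidelity_pure _ (unit_evolved t)) (pure _ (unit_evolved t)) /= => h.
  by rewrite -[LHS](subKr 1) -h subrr.
apply/matrixP => i j; rewrite [RHS]mxE.
by apply: is_cderive0 (comoving_derive H0_herm i j) => t; rewrite leak0 mxE.
Qed.

(** The susceptibility is the squared norm of N V Psi, and a projector does not increase norms. The
    lower bound removes the absolute value in the growth estimate. *)
Lemma dyn_fidelity_susceptibility_bounds :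
  0 <= dyn_fidelity_susceptibility H0 V psi phi
    <= sqnorm (V *m (psi *t phi : 'cV[C]_(m * d))).
Proof.
rewrite -/Psi; set v := sqnorm (N *m (V *m Psi)).
suff -> : dyn_fidelity_susceptibility H0 V psi phi = v.
  by rewrite sqnorm_ge0 /= /v NE sqnorm_proj_compl // gerBl sqnorm_ge0.
have ddF eps : derive1n 2 (dyn_fidelity H0 V psi phi eps) 0 = - 2 * eps ^+ 2 * v.
  have -> : dyn_fidelity H0 V psi phi eps =
      (fun t => 1 - sqnorm (N *m comoving (H0 + eps%:C *: V) t)).
    by apply/funext => t; apply: dyn_fidelityE.
  have Hh := perturbed_herm eps.
  rewrite (derive1n2_sqnorm (comoving_trig Hh) _ (comoving_derive Hh)); last first.
    by rewrite comoving0 ?NPsi.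
  (* Only eps V survives [N]; the scalar - i eps has squared modulus eps ^ 2, so the fidelity
     curvature is quadratic in eps. *)
  have -> : N *m ((0 -i* 1) *: (H0 + eps%:C *: V - HS *t 1%:M) *m Psi) =
      ((0 -i* 1) * eps%:C) *: (N *m (V *m Psi)).
    rewrite addrAC scalerDr [_ *m Psi]mulmxDl [N *m _]mulmxDr unperturbed_leak0 add0r.
    by rewrite scalerA -scalemxAl -scalemxAr.
  rewrite sqnormZ -/v mulrA; congr (_ * _ * _).
  by rewrite /cnorm2 /=; ring.
(* The second derivative of - 2 eps ^ 2 v is - 4 v, and the prefactor - 1 / 4 gives v. *)
rewrite /dyn_fidelity_susceptibility (_ : (fun _ => _) = fun eps => - 2 * eps ^+ 2 * v).
  have d1 (x : R) : is_derive x (1 : R) (fun eps => - 2 * eps ^+ 2 * v) (- 4 * x * v).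
    rewrite (_ : (fun _ => _) = cst (- 2 * v) * (id * id)).
      apply: (is_derive_eq (is_deriveM (is_derive_cst _ _ _)
        (is_deriveM (is_derive_id _ _) (is_derive_id _ _)))).
      by rewrite /GRing.scale /=; ring.
    by apply/funext => e; rewrite -[RHS]/(- 2 * v * (e * e)); ring.
  have d2 : is_derive (0 : R) (1 : R) (fun x => - 4 * x * v) (- 4 * v).
    rewrite (_ : (fun _ => _) = cst (- 4 * v) * id).
      apply: (is_derive_eq (is_deriveM (is_derive_cst _ _ _) (is_derive_id _ _))).
      by rewrite /GRing.scale /=; ring.
    by apply/funext => e; rewrite -[RHS]/(- 4 * v * e); ring.
  by rewrite derive1nS derive1n1 (derive1_eq d1) derive1E derive_val; field.
by apply/funext => eps; apply: ddF.
Qed.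

End Susceptibility.

(** * Growth with the number of qubits *)

Lemma unperturbed_hermitian (R : realType) m d (HS : 'M[R[i]]_m) HB
    (HSB : 'M[R[i]]_(m * d)) : hermitian_op HS -> hermitian_op HB ->
  hermitian_op HSB -> hermitian_op (unperturbed HS HB HSB).
Proof.
move=> HSh HBh HSBh; rewrite /hermitian_op /unperturbed 2!linearD /= 2!map_mxD.
by rewrite !trmxC_tens !trmxC1 HSh HBh HSBh.
Qed.

Theorem mainTheorem4 (R : realType) (d : nat) :
  (* every Hermitian V has a Pauli expansion *)
  (forall (n : nat) (V : 'M[R[i]]_(qdim n * d)), hermitian_op V ->
     exists (c : n.-tuple 'I_4 -> R) (B : n.-tuple 'I_4 -> 'M[R[i]]_d),
       V = pert c B) /\
  (* with at most 4 ^ n linearly independent terms *)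
  (forall (n : nat) (c : n.-tuple 'I_4 -> R) (B : n.-tuple 'I_4 -> 'M[R[i]]_d),
     (\dim <<[seq pert_term c B alpha | alpha : n.-tuple 'I_4]>>%VS
        <= 4 ^ n)%N) /\
  (* growth of the susceptibility with the number of qubits *)
  (forall (c : forall n : nat, n.-tuple 'I_4 -> R)
          (B : forall n : nat, n.-tuple 'I_4 -> 'M[R[i]]_d)
          (HS : forall n : nat, 'M[R[i]]_(qdim n))
          (HB : nat -> 'M[R[i]]_d)
          (HSB : forall n : nat, 'M[R[i]]_(qdim n * d))
          (phi : nat -> 'cV[R[i]]_d)
          (D : forall n : nat, {vspace 'cV[R[i]]_(qdim n)})
          (psi : forall n : nat, 'cV[R[i]]_(qdim n)),
     (forall (n : nat) (alpha : n.-tuple 'I_4),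
        c n.+1 (add_qubit alpha) = c n alpha /\
        B n.+1 (add_qubit alpha) = B n alpha) ->
     (* the couplings are bounded uniformly in the Pauli string *)
     (exists K : R, forall (n : nat) (alpha : n.-tuple 'I_4) (k l : 'I_d),
        `|(c n alpha)%:C * B n alpha k l| <= K%:C) ->
     (forall n : nat, hermitian_op (pert (c n) (B n))) ->
     (forall n : nat, hermitian_op (HS n)) ->
     (forall n : nat, hermitian_op (HB n)) ->
     (forall n : nat, hermitian_op (HSB n)) ->
     (forall n : nat, unit_vector (phi n)) ->
     (forall n : nat, decoherence_free (HS n)
        (unperturbed (HS n) (HB n) (HSB n)) (phi n) (D n)) ->
     (forall n : nat, psi n \in D n) ->
     (forall n : nat, unit_vector (psi n)) ->
     (fun n : nat => dyn_fidelity_susceptibility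
        (unperturbed (HS n) (HB n) (HSB n)) (pert (c n) (B n))
        (psi n) (phi n))
       =O_\oo (fun n : nat => (2 ^+ (4 * n) : R))).
Proof.
split; first by move=> n V _; apply: pert_expansion.
split; first by move=> n c B; exact: dim_span_pert_term.
move=> c B HS HB HSB phi D psi _ [K cBK] Vh HSh HBh HSBh phi1 dfs psiD psi1.
(* Adding 1 keeps the constant positive even when [d] or [K] is 0. *)
apply/eqO_exP; exists ((d * d)%:R * K ^+ 2 + 1).
  by rewrite ltr_wpDl // mulr_ge0 ?sqr_ge0.
apply: nearW => n /=.
have /andP[chi_ge0 chi_le] := dyn_fidelity_susceptibility_bounds (HSh n)
  (unperturbed_hermitian (HSh n) (HBh n) (HSBh n)) (Vh n) (phi1 n) (dfs n)
  (psiD n) (psi1 n).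
rewrite ger0_norm // ger0_norm ?exprn_ge0 // (le_trans chi_le) //.
apply: le_trans (sqnorm_pert_le (cBK n) (psi1 n) (phi1 n)) _.
by rewrite ler_wpM2r ?exprn_ge0 // lerDl.
Qed.
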